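(* Let $n$ be an integer with $n\geq 5$, and let $l,r$ be nonzero complex numbers such that $r^{2k}\ne1$ for $1\le k\le n$ and $r^{2k}\ne-1$ for $1\le k\le n-1$ (so that the Hecke algebras $\mathcal H(D_n)$ and $\mathcal H_{F,r^2}(n)$ are semisimple). If $l=\frac1r$, there exists a unique irreducible $\frac{n(n-1)}2$-dimensional invariant subspace inside $V_n$. Moreover, it is spanned over $\mathbb Q(l,r)$ by the vectors $t_{ij}=w_{ij}-\widehat{w_{ij}}$, $1\leq i<j\leq n$.
   Context: Put $m=\frac1r-r$ and $F=\mathbb Q(l,r)\subset\mathbb C$. $V_n$ is the $F$-vector space with basis $\{w_{ij},\widehat{w_{ij}}:1\le i<j\le n\}$. It carries endomorphisms $\nu_1,\dots,\nu_n$ defined as follows ($\overline{w_{s,t}}$ stands for either $w_{s,t}$ or $\widehat{w_{s,t}}$, same choice on both sides); they define a representation of the Cohen--Gijsbers--Wales algebra of type $D_n$. $\nu_1$: for $3\le i<j\le n$, $\nu_1(\widehat{w_{ij}})=m r^{j-5}(\widehat{w_{1,i}}-w_{1,i})+m r^{j-4}(\widehat{w_{2,i}}-w_{2,i})+m r^{i-3}(\widehat{w_{1,j}}-w_{1,j})+m r^{i-2}(\widehat{w_{2,j}}-w_{2,j})+m^2(r^{i+j-8}+r^{i+j-6})(\widehat{w_{12}}-w_{12})+r\,\widehat{w_{ij}}$; for $j\ge3$: $\nu_1(\widehat{w_{1j}})=w_{2j}$, $\nu_1(\widehat{w_{2j}})=w_{1j}+m r^{j-3}w_{12}-m\,w_{2j}$,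 $\nu_1(w_{2j})=\widehat{w_{1j}}+m r^{j-3}\widehat{w_{12}}-m\,w_{2j}$, $\nu_1(w_{1j})=\widehat{w_{2j}}+m r^{j-4}(\widehat{w_{12}}-w_{12})+m(\widehat{w_{1j}}-w_{1j})$; $\nu_1(\widehat{w_{12}})=\frac1l\widehat{w_{12}}$; $\nu_1(\overline{w_{s,t}})=r\,\overline{w_{s,t}}$ for all other basis vectors. $\nu_k$, $2\le k\le n$: $\nu_k(\overline{w_{k-1,t}})=\overline{w_{k,t}}$ for $t\ge k+1$; $\nu_k(\overline{w_{s,k-1}})=\overline{w_{s,k}}$ for $s\le k-2$; $\nu_k(\widehat{w_{k-1,k}})=r\,\widehat{w_{k-1,k}}$; $\nu_k(w_{k-1,k})=\frac1lw_{k-1,k}$; for $t\ge k+1$: $\nu_k(\widehat{w_{k,t}})=\widehat{w_{k-1,t}}+\frac ml r^{t-k-2}w_{k-1,k}-m\,\widehat{w_{k,t}}$ and $\nu_k(w_{k,t})=w_{k-1,t}+m r^{t-k-1}w_{k-1,k}-m\,w_{k,t}$; for $s\le k-2$: $\nu_k(\overline{w_{s,k}})=\overline{w_{s,k-1}}+\frac{m}{l\,r^{k-s-2}}w_{k-1,k}-m\,\overline{w_{s,k}}$; $\nu_k(\overline{w_{s,t}})=r\,\overline{w_{s,t}}$ for all other basis vectors. An invariant subspace of $V_n$ is an $F$-subspace stable under all $\nu_1,\dots,\nu_n$; it is irreducible if it is nonzero and has no invariant subspaces other than $0$ and itself. $\mathcal H(D_n)$ is the $F$-algebra with generators $g_1,\dots,g_n$,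 the Artin relations of type $D_n$ (node $1$ joined to node $3$, node $i$ joined to $i+1$ for $2\le i\le n-1$) and $g_i^2+mg_i=1$; $\mathcal H_{F,r^2}(n)$ is the Iwahori--Hecke algebra of $\mathrm{Sym}(n)$ with parameter $r^2$ over $F$. *)

(* Defs.v *)
From HB Require Import structures.
From mathcomp Require Import all_boot all_order all_algebra.
From mathcomp Require Import boolp reals complex.

Set Implicit Arguments.
Unset Strict Implicit.
Unset Printing Implicit Defensive.

Import Order.TTheory GRing.Theory Num.Theory.
Local Open Scope ring_scope.

(* The field Q(l, r): the intersection of all subfields of C containing l    *)
(* and r ([divring_closed]: contains 1, stable under - and /).               *)
Section GeneratedSubfield.
Context {C : fieldType}.
Variables l r : C.

Definition in_gen_field : {pred C} := fun z : C =>
  `[< forall K : {pred C},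
        GRing.divring_closed K -> l \in K -> r \in K -> z \in K >].

Lemma in_gen_fieldP (z : C) :
  reflect (forall K : {pred C},
             GRing.divring_closed K -> l \in K -> r \in K -> z \in K)
          (z \in in_gen_field).
Proof. exact: asboolP. Qed.

Fact in_gen_field_divring_closed : GRing.divring_closed in_gen_field.
Proof.
split=> [|x y /in_gen_fieldP Kx /in_gen_fieldP Ky
         |x y /in_gen_fieldP Kx /in_gen_fieldP Ky];
  apply/in_gen_fieldP => K clK lK rK; case: (clK) => K1 KB KD //.
  by apply: KB; [apply: Kx | apply: Ky].
by apply: KD; [apply: Kx | apply: Ky].
Qed.

HB.instance Definition _ :=
  GRing.isDivringClosed.Build C in_gen_field in_gen_field_divring_closed.

Fact l_in_gen_field : l \in in_gen_field.
Proof. by apply/in_gen_fieldP. Qed.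

Fact r_in_gen_field : r \in in_gen_field.
Proof. by apply/in_gen_fieldP. Qed.

Record gen_field := GenField {
  gen_field_val : C;
  gen_field_valP : gen_field_val \in in_gen_field
}.

HB.instance Definition _ := [isSub for gen_field_val].
HB.instance Definition _ := [Choice of gen_field by <:].
HB.instance Definition _ := [SubChoice_isSubComUnitRing of gen_field by <:].
HB.instance Definition _ := [SubComUnitRing_isSubIntegralDomain of gen_field by <:].
HB.instance Definition _ := [SubIntegralDomain_isSubField of gen_field by <:].

Definition gen_l : gen_field := GenField l_in_gen_field.
Definition gen_r : gen_field := GenField r_in_gen_field.

End GeneratedSubfield.

Arguments gen_field {C} l r.
Arguments gen_l {C} l r.
Arguments gen_r {C} l r.

(* Positions (i, j) with 1 <= i < j <= n; indices are kept 1-based. *)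
Definition ij_index (n : nat) :=
  {p : 'I_n.+1 * 'I_n.+1 | (0 < p.1)%N && (p.1 < p.2)%N}.

Section Representation.
Variables (F : fieldType) (l r : F) (n : nat).

(* The boolean tells w_{ij} ([false]) from its hatted version ([true]). *)
Definition V_basis : finType := (bool * ij_index n)%type.
Definition V := {ffun V_basis -> F^o}.

(* [wbar h i j] is the basis vector w_{ij} (h = false) or hat w_{ij}         *)
(* (h = true) if 1 <= i < j <= n, and is 0 for other values of i and j.      *)
Definition wbar (h : bool) (i j : nat) : V :=
  [ffun b : V_basis =>
     ([&& b.1 == h, (val b.2).1 == i :> nat & (val b.2).2 == j :> nat])%:R].
Definition w := wbar false.
Definition wh := wbar true.

Definition m : F := 1 / r - r.

(* In the next three functions the argument (h, s, t) stands for the basis     *)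
(* vector [wbar h s t], 1 <= s < t <= n, and the value is its image.         *)
(* Exponents of r may be negative, hence the casts to int.                   *)
Definition nu1_basis (h : bool) (s t : nat) : V :=
  if (3 <= s)%N then
    if h then
      let i := s in let j := t in
        (m * r ^ (j%:Z - 5)) *: (wh 1 i - w 1 i)
      + (m * r ^ (j%:Z - 4)) *: (wh 2 i - w 2 i)
      + (m * r ^ (i%:Z - 3)) *: (wh 1 j - w 1 j)
      + (m * r ^ (i%:Z - 2)) *: (wh 2 j - w 2 j)
      + (m ^+ 2 * (r ^ (i%:Z + j%:Z - 8) + r ^ (i%:Z + j%:Z - 6)))
          *: (wh 1 2 - w 1 2)
      + r *: wh i j
    else r *: w s t
  else if (3 <= t)%N then
    let j := t in
    match h, s with
    | true, 1%N => w 2 j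
    | true, _ => w 1 j + (m * r ^ (j%:Z - 3)) *: w 1 2 - m *: w 2 j
    | false, 1%N => wh 2 j + (m * r ^ (j%:Z - 4)) *: (wh 1 2 - w 1 2)
                    + m *: (wh 1 j - w 1 j)
    | false, _ => wh 1 j + (m * r ^ (j%:Z - 3)) *: wh 1 2 - m *: w 2 j
    end
  else if h then (1 / l) *: wh 1 2
  else r *: w 1 2.

Definition nuk_basis (k : nat) (h : bool) (s t : nat) : V :=
  if (s == k.-1) && (t == k) then
    if h then r *: wh s t else (1 / l) *: w s t
  else if s == k.-1 then wbar h k t
  else if t == k.-1 then wbar h s k
  else if s == k then
    if h then wh k.-1 t + (m / l * r ^ (t%:Z - k%:Z - 2)) *: w k.-1 k
              - m *: wh k t
    else w k.-1 t + (m * r ^ (t%:Z - k%:Z - 1)) *: w k.-1 k - m *: w k t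
  else if t == k then
    wbar h s k.-1 + (m / (l * r ^ (k%:Z - s%:Z - 2))) *: w k.-1 k
      - m *: wbar h s k
  else r *: wbar h s t.

Definition nu_basis (k : nat) : bool -> nat -> nat -> V :=
  if k == 1%N then nu1_basis else nuk_basis k.

Definition nu_fun (k : nat) (v : V) : V :=
  \sum_(b : V_basis) v b *: nu_basis k b.1 (val b.2).1 (val b.2).2.

Fact nu_fun_is_linear k : linear (nu_fun k).
Proof.
move=> a u v; rewrite /nu_fun scaler_sumr -big_split /=.
by apply: eq_bigr => b _; rewrite !ffunE scalerDl scalerA.
Qed.

HB.instance Definition _ (k : nat) :=
  GRing.isLinear.Build F V V _ (nu_fun k) (nu_fun_is_linear k).

Definition nu (k : nat) : 'End(V) := linfun (nu_fun k).

Definition invariant (U : {vspace V}) : Prop :=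
  forall k : nat, (1 <= k <= n)%N -> (nu k @: U <= U)%VS.

Definition irreducible_invariant (U : {vspace V}) : Prop :=
  [/\ invariant U, U != 0%VS &
      forall W : {vspace V}, invariant W -> (W <= U)%VS -> W = 0%VS \/ W = U].

Definition tvec (b : ij_index n) : V :=
  w (val b).1 (val b).2 - wh (val b).1 (val b).2.

Definition tspan : {vspace V} := <<[seq tvec b | b : ij_index n]>>%VS.

End Representation.

(* Main.v *)
Require Import Defs.
From mathcomp Require Import all_boot all_order all_algebra.
From mathcomp Require Import zify ring.
From mathcomp Require Import reals complex.

Import Order.TTheory GRing.Theory Num.Theory.
Local Open Scope ring_scope.

Set Implicit Arguments.
Unset Strict Implicit.
Unset Printing Implicit Defensive.

(** Let [t_ij = w_ij - wh_ij], where [wh] is the hatted vector, let [T] be the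
    span of the [t_ij], and put [m = 1/r - r].  When [l = 1/r] the space [T] is
    invariant.  Indeed, for [k >= 2], the multiples of [w_(k-1,k)] that occur in
    the images under [nu_k] of the other vectors [w_ij] and [wh_ij] cancel in
    the difference, and [nu_k] acts on [T] as a deformed permutation of the
    pairs of indices (lemma [nuT]).

    Irreducibility of [T] ([tspan_minimal]).  On [T] the operator [nu_1 - r]
    takes its values in the span of the vectors
    [b_j = t_1j + r t_2j + m r^(j-3) t_12], [3 <= j <= n], and [nu_2 - r] in the
    span of the [a_j = t_1j - t_2j / r].  On both families [nu_4, ..., nu_n] act
    as the Hecke algebra of Sym(n-2) acts on its natural module ([chain]), so
    that [nu_k - r] maps every combination of the family to a multiple of the
    difference of two consecutive vectors ([chain_sum]).  Let [W] be a nonzero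
    invariant subspace of [T].
    - Some [v] in [W] has [nu_1 v != r v]: if [nu_1] were [r] on [W], then one
      linear form, and its translates by the other generators, would vanish on
      [W]; these force every coordinate to vanish, because
      [r^(2(n-2)) != -1] ([nu1_scalar_eq0]).
    - So [W] contains a nonzero combination of the [b_j].  Applying
      [nu_4 - r, ..., nu_n - r], either [W] contains all the differences
      [b_(j-1) - b_j / r], or it contains the sum of the [r^j b_j].  The
      operators [(nu_2 - r) nu_3] and [(nu_1 - r) nu_3] carry combinations of
      the [b_j] to combinations of the [a_j] and conversely; in either case
      [W] contains [a_3 - a_4 / r], in the second one because
      [r^(2(n-3)) != -1] ([cvec_a_of_b], [cvec_a_of_sum]).
    - From [a_3 - a_4 / r] one obtains [b_3 + r b_4], and, since [n >= 5],
      also [a_4 - a_5 / r], then [b_4 - b_5 / r] and [b_3 - b_4 / r].  As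
      [r^2 != -1], this gives [b_3], and as [r^4 != -1], it gives [t_12], whose
      translates include all the [t_ij].

    Uniqueness ([no_complement]).  Let [U] be an irreducible invariant subspace
    of the dimension of [T], which is half of the dimension of [V].  If [U] is
    not [T], then [U] meets [T] in 0, so that [U] and [T] span [V].  The
    operator [nu_2^2 + m nu_2 - 1] vanishes on [T] ([hecke_nu2]), but sends
    [w_13] to [m w_12], where [m] is not 0; hence [w_12] lies in [U].  Applying
    [nu_3], [nu_2], [nu_1] and [nu_3] to it one finds that [wh_12] lies in [U]
    too, and [t_12] is a nonzero vector of both [U] and [T]. *)

(** * The vectors t_ij *)

Section BasisVectors.
Context {F : fieldType} {n : nat}.

Local Notation w := (Defs.w F n).
Local Notation wh := (Defs.wh F n).

(** The vector [t_ij], which is 0 unless [1 <= i < j <= n]; it is locked so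
    that linearity lemmas do not split it into its two terms. *)
Definition tij (i j : nat) : V F n := locked (w i j - wh i j).

Lemma tijE i j : tij i j = w i j - wh i j.
Proof. by rewrite /tij -lock. Qed.

Lemma ij_index_exists i j : (0 < i < j)%N -> (j <= n)%N ->
  exists p : ij_index n, (val p).1 = i :> nat /\ (val p).2 = j :> nat.
Proof.
move=> /andP[i0 ij] jn; have [i1 j1] : (i < n.+1)%N /\ (j < n.+1)%N by lia.
have P : (0 < (Ordinal i1, Ordinal j1).1)%N
         && ((Ordinal i1, Ordinal j1).1 < (Ordinal i1, Ordinal j1).2)%N.
  by rewrite /= i0 ij.
by exists (@exist _ (fun p : 'I_n.+1 * 'I_n.+1 =>
  (0 < p.1)%N && (p.1 < p.2)%N) _ P).
Qed.

Lemma ij_index_inj (p q : ij_index n) :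
  (val p).1 = (val q).1 :> nat -> (val p).2 = (val q).2 :> nat -> p = q.
Proof.
case: p q => [[a b] P] [[c d] Q] /= e1 e2; apply: val_inj => /=.
by congr pair; apply: val_inj.
Qed.

Lemma ij_indexP (p : ij_index n) :
  (0 < (val p).1 < (val p).2)%N /\ ((val p).2 <= n)%N.
Proof. by case: p => [[i j] /= P]; split; [exact: P | rewrite -ltnS ltn_ord]. Qed.

Lemma wbar_out h i j : ~~ ((0 < i < j)%N && (j <= n)%N) -> wbar F n h i j = 0.
Proof.
move=> H; apply/ffunP => b; rewrite !ffunE.
case: (altP and3P) => // -[_ /eqP h2 /eqP h3]; case/negP: H; rewrite -h2 -h3.
by have [-> ->] := ij_indexP b.2.
Qed.

End BasisVectors.

(** Equality of two explicit linear combinations in [V F n], proved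
    coordinate by coordinate. *)
Ltac vec_expand :=
  repeat match goal with
  | |- context [@tij ?F ?n ?i ?j] => generalize (@tij F n i j); intro
  | |- context [Defs.w ?F ?n ?i ?j] => generalize (Defs.w F n i j); intro
  | |- context [Defs.wh ?F ?n ?i ?j] => generalize (Defs.wh F n i j); intro
  end;
  apply/ffunP => ?; rewrite !ffunE /GRing.scale /=.

Ltac vec_ring := vec_expand; ring.

Ltac vec_field nz := vec_expand; field; rewrite ?nz ?oner_neq0.

(** * Action of the generators on the span of the t_ij *)

Section Action.
Context {F : fieldType} {n : nat} {r : F}.
Hypothesis r_neq0 : r != 0.

Local Notation m := (Defs.m r).
Local Notation nu := (Defs.nu r^-1 r n).
Local Notation w := (Defs.w F n).
Local Notation wh := (Defs.wh F n).
Local Notation T := (@tij F n).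

Lemma nu_wbar k h i j : (0 < i < j)%N -> (j <= n)%N ->
  nu k (wbar F n h i j) = nu_basis r^-1 r n k h i j.
Proof.
move=> ij jn; have [p [<- <-]] := ij_index_exists ij jn.
rewrite lfunE /= /nu_fun (bigD1 (h, p)) //= big1 => [|b nb].
  by rewrite ffunE /= !eqxx /= scale1r addr0.
rewrite ffunE; case: (altP and3P) => [[/eqP h1 /eqP h2 /eqP h3]|_];
  last by rewrite scale0r.
case/negP: nb; apply/eqP; case: b h1 h2 h3 => h' q /= -> h2 h3.
by congr pair; apply: ij_index_inj.
Qed.

(** The hypothesis [l = 1/r] is used here: the images of [w_kj] and [wh_kj] then
    have the same component along [w_(k-1,k)], and [w_(k-1,k)] and
    [wh_(k-1,k)] have the same eigenvalue [r]. *)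
Lemma nuT k i j : (0 < i < j)%N -> (j <= n)%N -> (2 <= k)%N ->
  nu k (T i j) =
    if (i == k.-1) && (j == k) then r *: T i j
    else if i == k.-1 then T k j
    else if j == k.-1 then T i k
    else if i == k then T k.-1 j - m *: T k j
    else if j == k then T i k.-1 - m *: T i k
    else r *: T i j.
Proof.
move=> ij jn k2; rewrite tijE linearB /= /Defs.w /Defs.wh !nu_wbar // /nu_basis.
rewrite (_ : (k == 1%N) = false); last by lia.
rewrite /nuk_basis !tijE /Defs.w /Defs.wh; move: (wbar F n) => W.
case: ifP => _; first by rewrite div1r invrK scalerBr.
case: ifP => _ //; case: ifP => _ //; case: ifP => [/eqP ei|_]; last first.
  case: ifP => _; last by rewrite scalerBr.
  by vec_ring.
have -> : m / r^-1 * r ^ (j%:Z - k%:Z - 2) = m * r ^ (j%:Z - k%:Z - 1).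
  rewrite invrK -mulrA; congr (_ * _).
  by rewrite -{1}(expr1z r) -expfzDr //; congr (r ^ _); lia.
by vec_ring.
Qed.

(** The vectors [b_j] and [a_j], [j >= 3], which span the images of [nu_1 - r]
    and [nu_2 - r] on the span of the [t_ij].  They are locked for the same
    reason as [tij]. *)
Definition bvec j : V F n :=
  locked (T 1 j + r *: T 2 j + (m * r ^+ (j - 3)) *: T 1 2).
Definition avec j : V F n := locked (T 1 j - r^-1 *: T 2 j).

Lemma avecE j : avec j = T 1 j - r^-1 *: T 2 j.
Proof. by rewrite /avec -lock. Qed.

Lemma bvecE j :
  bvec j = T 1 j + r *: T 2 j + (m * r ^+ (j - 3)) *: T 1 2.
Proof. by rewrite /bvec -lock. Qed.

(** Trades the integer exponents of the definition of [nu_1] for natural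
    ones. *)
Lemma expz_shift (d : nat) (z : int) k : (z = k%:Z - d%:Z) ->
  r ^ z = (r ^+ d)^-1 * r ^+ k.
Proof.
by move=> ->; rewrite addrC expfzDr // -exprnN exprnP.
Qed.

Lemma nu1_T1 j : (3 <= j <= n)%N ->
  nu 1 (T 1 j) = r *: T 1 j - r^-1 *: bvec j.
Proof.
move=> /andP[j3 jn]; rewrite !tijE linearB /= !nu_wbar //; try lia.
rewrite /nu_basis /= /nu1_basis /= j3 !bvecE !tijE.
rewrite (@expz_shift 1 _ (j - 3)); last by lia.
move: (r ^+ (j - 3)) => x; rewrite /Defs.m.
by vec_field r_neq0.
Qed.

Lemma nu1_T2 j : (3 <= j <= n)%N ->
  nu 1 (T 2 j) = r *: T 2 j - bvec j.
Proof.
move=> /andP[j3 jn]; rewrite !tijE linearB /= !nu_wbar //; try lia.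
rewrite /nu_basis /= /nu1_basis /= j3 !bvecE !tijE.
rewrite (@expz_shift 0 _ (j - 3)); last by lia.
move: (r ^+ (j - 3)) => x; rewrite /Defs.m.
by vec_field r_neq0.
Qed.

Lemma nu1_T12 : (2 <= n)%N -> nu 1 (T 1 2) = r *: T 1 2.
Proof.
move=> n2; rewrite !tijE linearB /= !nu_wbar // /nu_basis /= /nu1_basis /=.
by rewrite div1r invrK scalerBr.
Qed.

Lemma nu1_T i j : (3 <= i < j)%N -> (j <= n)%N ->
  nu 1 (T i j) = r *: T i j + (m * r ^+ (j - 4) / r) *: bvec i
                 + (m * r ^+ (i - 3)) *: bvec j.
Proof.
move=> /andP[i3 ij] jn; rewrite !tijE linearB /= !nu_wbar //; try lia.
rewrite /nu_basis /= /nu1_basis /= i3 !bvecE !tijE.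
rewrite (@expz_shift 1 (j%:Z - 5) (j - 4)); last by lia.
rewrite (@expz_shift 0 (j%:Z - 4) (j - 4)); last by lia.
rewrite (@expz_shift 0 (i%:Z - 3) (i - 3)); last by lia.
rewrite (_ : i%:Z - 2 = (i - 3).+1%:Z); last by lia.
rewrite (@expz_shift 1 (i%:Z + j%:Z - 8) ((i - 3) + (j - 4))); last by lia.
rewrite (_ : i%:Z + j%:Z - 6 = ((i - 3) + (j - 4)).+1%:Z); last by lia.
rewrite -!exprnP !exprS exprD (_ : j - 3 = (j - 4).+1)%N; last by lia.
rewrite exprS; move: (r ^+ (j - 4)) (r ^+ (i - 3)) => x y; rewrite /Defs.m.
by vec_field r_neq0.
Qed.

Lemma nu2_T1 j : (3 <= j <= n)%N ->
  nu 2 (T 1 j) = r *: T 1 j - r *: avec j.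
Proof.
move=> /andP[j3 jn]; rewrite nuT //; try lia.
rewrite /= (_ : (j == 2) = false); last by lia.
by rewrite !avecE; vec_field r_neq0.
Qed.

Lemma nu2_T2 j : (3 <= j <= n)%N ->
  nu 2 (T 2 j) = r *: T 2 j + avec j.
Proof.
move=> /andP[j3 jn]; rewrite nuT //; try lia.
rewrite /= (_ : (j == 1) = false); last by lia.
by rewrite !avecE /Defs.m; vec_field r_neq0.
Qed.

Lemma nu2_T12 : (2 <= n)%N -> nu 2 (T 1 2) = r *: T 1 2.
Proof. by move=> n2; rewrite nuT. Qed.

Lemma nu2_T i j : (3 <= i < j)%N -> (j <= n)%N -> nu 2 (T i j) = r *: T i j.
Proof.
move=> /andP[i3 ij] jn; rewrite nuT //; try lia.
by rewrite /=; do 5 (rewrite ifN; last by lia).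
Qed.

Lemma nuT_far k i j : (0 < i < j)%N -> (j <= n)%N -> (i < k.-1)%N ->
  nu k (T i j) =
    if j == k.-1 then T i k
    else if j == k then T i k.-1 - m *: T i k
    else r *: T i j.
Proof.
move=> ij jn ik; rewrite nuT //; last by lia.
rewrite (_ : (i == k.-1) = false); last by lia.
by rewrite (_ : (i == k) = false) //; lia.
Qed.

(** The rule by which [nu_4, ..., nu_n] act on both families [a_j] and [b_j],
    [3 <= j <= n]: the natural module of the Hecke algebra of Sym(n-2). *)
Definition chain (g : nat -> V F n) :=
  forall k j, (4 <= k <= n)%N -> (3 <= j <= n)%N ->
  nu k (g j) = if j == k.-1 then g k
               else if j == k then g k.-1 - m *: g k else r *: g j.

Lemma chain_avec : chain avec.
Proof.
move=> k j /andP[k4 kn] /andP[j3 jn]; rewrite !avecE linearB linearZ /=.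
rewrite !nuT_far; try lia.
case: ifP => _; first by [].
case: ifP => _; by vec_ring.
Qed.

Lemma chain_bvec : chain bvec.
Proof.
move=> k j /andP[k4 kn] /andP[j3 jn]; rewrite !bvecE !linearD !linearZ /=.
rewrite !nuT_far; try lia.
have [-> ->] : (2 == k.-1)%N = false /\ (2 == k)%N = false by lia.
case: ifP => [/eqP ej|_].
  rewrite (_ : k - 3 = (j - 3).+1)%N; last by lia.
  by rewrite exprS; vec_ring.
case: ifP => [/eqP ej|_].
  rewrite ej (_ : k - 3 = (k.-1 - 3).+1)%N; last by lia.
  (* The components along t_12 match because m^2 = m / r - m r. *)
  by rewrite exprS; move: (r ^+ _) => x; rewrite /Defs.m; vec_field r_neq0.
by vec_ring.
Qed.

End Action.

(** From here on, [nu] is used only through linearity and the formulas above;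
    unfolding it during unification is very costly. *)
#[local] Opaque nu.

(** * The families a_j and b_j *)

Section Generation.
Context {F : fieldType} {n : nat} {r : F}.
Hypothesis r_neq0 : r != 0.

Local Notation m := (Defs.m r).
Local Notation nu := (Defs.nu r^-1 r n).
Local Notation T := (@tij F n).
Local Notation avec := (@avec F n r).
Local Notation bvec := (@bvec F n r).

Lemma nuD k u v : nu k (u + v) = nu k u + nu k v.
Proof. exact: linearD. Qed.

Lemma nuB k u v : nu k (u - v) = nu k u - nu k v.
Proof. exact: linearB. Qed.

Lemma nuZ k x v : nu k (x *: v) = x *: nu k v.
Proof. exact: linearZ. Qed.

(** The difference of consecutive vectors of a chain; it spans the image of
    [nu_k - r] on the chain. *)
Definition cvec (g : nat -> V F n) k := g k.-1 - r^-1 *: g k.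

Lemma chain_cvec_up g k : @chain F n r g -> (4 <= k < n)%N ->
  nu k.+1 (cvec g k) - r *: cvec g k = cvec g k.+1.
Proof.
move=> cg kn; rewrite /cvec nuB nuZ /= !cg; try lia.
have [-> ->] : (k.-1 == k) = false /\ (k.-1 == k.+1) = false by lia.
rewrite /= eqxx; move: (g _) (g _) (g _) => x y z.
by vec_field r_neq0.
Qed.

Lemma chain_cvec_down g k : @chain F n r g -> (4 <= k < n)%N ->
  nu k (cvec g k.+1) - r *: cvec g k.+1 = cvec g k.
Proof.
move=> cg kn; rewrite /cvec nuB nuZ /= !cg; try lia.
have [-> [-> ->]] : (k == k.-1) = false /\ (k.+1 == k.-1) = false /\
  (k.+1 == k) = false by lia.
rewrite /= eqxx /Defs.m; move: (g _) (g _) (g _) => x y z.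
by vec_field r_neq0.
Qed.

(** Thus [nu_k - r] maps every combination of the chain to a multiple of one
    vector, with a factor that vanishes exactly when [c_k = r c_(k-1)]. *)
Lemma chain_sum g (c : nat -> F) k : @chain F n r g -> (4 <= k <= n)%N ->
  let S := \sum_(3 <= j < n.+1) c j *: g j in
  nu k S - r *: S = (c k - r * c k.-1) *: cvec g k.
Proof.
move=> cg kn /=; rewrite linear_sum scaler_sumr -sumrB.
rewrite (eq_big_nat _ _ (F2 := fun j =>
  (if j == k.-1 then (- r * c j) *: cvec g k else 0)
  + (if j == k then c j *: cvec g k else 0))).
  rewrite big_split /= -!big_mkcond /= !big_nat1_eq.
  do 2 (rewrite ifT; last by lia).
  by rewrite -scalerDl addrC mulNr.
move=> j jn; rewrite linearZ /= cg; try lia.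
rewrite /cvec; case: ifP => [/eqP ->|_].
  rewrite (_ : (k.-1 == k) = false); last by lia.
  move: (g _) (g _) => x y.
  by vec_field r_neq0.
rewrite /Defs.m; case: ifP => [/eqP ->|_].
  move: (g _) (g _) => x y.
  by vec_field r_neq0.
by rewrite scalerA mulrC -scalerA subrr addr0.
Qed.

(** The operator [(nu_k - r) nu_3], used for [k = 1, 2] to pass from one of
    the two chains to the other.  It is locked so that [rewrite] recognizes
    its instances without unfolding [nu]. *)
Definition twist k v := locked (nu k (nu 3 v) - r *: nu 3 v).

Lemma twistE k v : twist k v = nu k (nu 3 v) - r *: nu 3 v.
Proof. by rewrite /twist -lock. Qed.

Lemma twistD k u v : twist k (u + v) = twist k u + twist k v.
Proof.
rewrite !twistE; move: (nu k) (nu 3) => f g.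
by rewrite (linearD g) (linearD f) scalerDr opprD addrACA.
Qed.

Lemma twistZ k x v : twist k (x *: v) = x *: twist k v.
Proof.
rewrite !twistE; move: (nu k) (nu 3) => f g.
by rewrite (linearZ_LR g) (linearZ_LR f) scalerBr !scalerA (mulrC r).
Qed.

Lemma twist_sum k (c : nat -> F) (g : nat -> V F n) a b :
  twist k (\sum_(a <= j < b) c j *: g j) = \sum_(a <= j < b) c j *: twist k (g j).
Proof.
elim/big_rec2: _ => [|j v u _ <-]; last by rewrite twistD twistZ.
by rewrite -(scale0r 0) twistZ !scale0r.
Qed.

Lemma twist_cvec k g j :
  twist k (cvec g j) = twist k (g j.-1) - r^-1 *: twist k (g j).
Proof. by rewrite /cvec twistD -scaleNr twistZ scaleNr. Qed.

Hypothesis n_ge5 : (5 <= n)%N.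

Lemma nu3_b3 : nu 3 (bvec 3) = T 1 2 + r ^+ 2 *: T 2 3.
Proof.
rewrite !bvecE expr0 mulr1 !nuD !nuZ /= !nuT //=; try lia.
by vec_ring.
Qed.

Lemma nu3_b j : (4 <= j <= n)%N ->
  nu 3 (bvec j) = r *: T 1 j + r *: T 3 j + (m * r ^+ (j - 3)) *: T 1 3.
Proof.
move=> jn.
rewrite !bvecE !nuD !nuZ /= !nuT //=; try lia.
by do 3 (rewrite ifN; last by lia).
Qed.

Lemma nu3_a3 : nu 3 (avec 3) = T 1 2 - m *: T 1 3 - T 2 3.
Proof.
rewrite !avecE nuB nuZ /= !nuT //=; try lia.
by rewrite scalerA mulVf // scale1r.
Qed.

Lemma nu3_a j : (4 <= j <= n)%N ->
  nu 3 (avec j) = r *: T 1 j - r^-1 *: T 3 j.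
Proof.
move=> jn.
rewrite !avecE nuB nuZ /= !nuT //=; try lia.
by do 3 (rewrite ifN; last by lia).
Qed.

Lemma twist2_b3 :
  twist 2 (bvec 3) = r ^+ 2 *: avec 3.
Proof.
rewrite twistE; move: nu3_b3; generalize (nu 3 (bvec 3)) => _ ->.
rewrite nuD nuZ /= (nu2_T12 r_neq0); last by lia.
rewrite (nu2_T2 r_neq0); last by lia.
by move: (avec 3) => x; vec_ring.
Qed.

Lemma twist2_b j : (4 <= j <= n)%N ->
  twist 2 (bvec j)
  = - r ^+ 2 *: avec j - (m * r ^+ (j - 2)) *: avec 3.
Proof.
move=> jn; rewrite twistE; move: (nu3_b jn); generalize (nu 3 (bvec j)) => _ ->.
rewrite !nuD !nuZ /=.
rewrite (nu2_T1 r_neq0); last by lia.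
rewrite (nu2_T1 r_neq0); last by lia.
rewrite (nu2_T r_neq0); [| lia | lia].
rewrite (_ : j - 2 = (j - 3).+1)%N; last by lia.
by rewrite (exprS r (j - 3)); move: (avec j) (avec 3) => x y; vec_ring.
Qed.

Lemma twist1_a3 :
  twist 1 (avec 3) = (r ^+ 2)^-1 *: bvec 3.
Proof.
rewrite twistE; move: nu3_a3; generalize (nu 3 (avec 3)) => _ ->.
rewrite !nuB nuZ /= nu1_T12; last by lia.
rewrite (nu1_T1 r_neq0); last by lia.
rewrite (nu1_T2 r_neq0); last by lia.
move: (bvec 3) => x; rewrite /Defs.m.
by vec_field r_neq0.
Qed.

Lemma twist1_a j : (4 <= j <= n)%N ->
  twist 1 (avec j)
  = - (r ^+ 2)^-1 *: bvec j - (m * r ^+ (j - 4) / r ^+ 2) *: bvec 3.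
Proof.
move=> jn; rewrite twistE; move: (nu3_a jn); generalize (nu 3 (avec j)) => _ ->.
rewrite nuB !nuZ /= (nu1_T1 r_neq0); last by lia.
rewrite (nu1_T r_neq0); [| lia | lia].
rewrite subnn expr0 mulr1; move: (bvec j) (bvec 3) (r ^+ (j - 4)) => x y z.
by rewrite /Defs.m; vec_field r_neq0.
Qed.

End Generation.

(** * Coordinates on the span of the t_ij *)

Section Coordinates.
Context {F : fieldType} {n : nat}.
Local Notation T := (@tij F n).

Lemma tvecE (p : ij_index n) : tvec F p = T (val p).1 (val p).2.
Proof. by rewrite tijE. Qed.

Lemma tij_in i j : T i j \in tspan F n.
Proof.
have [/andP[ij jn]|out] := boolP ((0 < i < j)%N && (j <= n)%N).
  have [p [<- <-]] := ij_index_exists ij jn.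
  by rewrite -tvecE memv_span //; apply: codom_f.
by rewrite tijE /w /wh !wbar_out // subrr mem0v.
Qed.

(** To prove a linear statement on the whole span it suffices to treat the
    vectors [t_ij]. *)
Lemma tspan_ind (P : V F n -> Prop) :
  P 0 ->
  (forall x i j u, (0 < i < j)%N -> (j <= n)%N -> u \in tspan F n -> P u ->
     P (x *: T i j + u)) ->
  forall v, v \in tspan F n -> P v.
Proof.
move=> P0 PS v; rewrite /tspan => /(@coord_span _ _ _ (in_tuple _)) ->.
suff [] : (\sum_i coord (in_tuple [seq tvec F b | b : ij_index n]) i v
   *: (in_tuple [seq tvec F b | b : ij_index n])`_i \in tspan F n) /\
   P (\sum_i coord (in_tuple [seq tvec F b | b : ij_index n]) i v
   *: (in_tuple [seq tvec F b | b : ij_index n])`_i) by [].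
elim/big_rec: _ => [|i u _ [uT Pu]]; first by rewrite mem0v.
have /codomP[p ->] : (in_tuple [seq tvec F b | b : ij_index n])`_i
    \in [seq tvec F b | b : ij_index n] by apply: mem_nth.
have [ij jn] := ij_indexP p.
rewrite tvecE; split; last exact: PS.
by rewrite memvD ?memvZ ?tij_in.
Qed.

(** The coordinate of [v] along [w_ij], as a function of natural indices (it
    is 0 unless [1 <= i < j <= n]).  On the span of the [t_ij] it is also the
    coordinate along [t_ij]. *)
Definition wcoef (v : V F n) (i j : nat) : F :=
  \sum_(p : ij_index n | ((val p).1 == i :> nat) && ((val p).2 == j :> nat))
     v (false, p).

Lemma wcoefD u v i j : wcoef (u + v) i j = wcoef u i j + wcoef v i j.
Proof. by rewrite /wcoef -big_split /=; apply: eq_bigr => p _; rewrite ffunE. Qed.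

Lemma wcoefZ x v i j : wcoef (x *: v) i j = x * wcoef v i j.
Proof. by rewrite /wcoef mulr_sumr; apply: eq_bigr => p _; rewrite ffunE. Qed.

Lemma wcoefN v i j : wcoef (- v) i j = - wcoef v i j.
Proof. by rewrite -scaleN1r wcoefZ mulN1r. Qed.

Lemma wcoef0 i j : wcoef 0 i j = 0.
Proof. by rewrite -(scale0r 0) wcoefZ mul0r. Qed.

Definition wcoefE := (wcoefD, wcoefN, wcoefZ, wcoef0).

Lemma wcoef_ij v (p : ij_index n) : wcoef v (val p).1 (val p).2 = v (false, p).
Proof.
rewrite /wcoef (big_pred1 p) // => q /=; apply/andP/eqP => [[/eqP h1 /eqP h2]|->].
Qed.

Lemma wcoef_tij i j s t : (0 < s < t)%N -> (t <= n)%N ->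
  wcoef (T i j) s t = ((s == i) && (t == j))%:R.
Proof.
move=> st tn; have [p [<- <-]] := ij_index_exists st tn.
by rewrite wcoef_ij tijE !ffunE /= subr0.
Qed.

Lemma wcoef_eq0 v : v \in tspan F n ->
  (forall i j, (0 < i < j)%N -> (j <= n)%N -> wcoef v i j = 0) -> v = 0.
Proof.
move=> vT v0.
have -> : v = \sum_(p : ij_index n) wcoef v (val p).1 (val p).2 *: tvec F p.
  elim/tspan_ind: vT => [|x i j u ij jn _ IH].
    by rewrite big1 // => p _; rewrite wcoef0 scale0r.
  rewrite [in LHS]IH; under [RHS]eq_bigr => p _ do rewrite wcoefD wcoefZ scalerDl.
  rewrite big_split /=; congr (_ + _).
  have [p [<- <-]] := ij_index_exists ij jn.
  rewrite (bigD1 p) //= big1 => [|q qp].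
    have [h1 h2] := ij_indexP p.
    by rewrite addr0 wcoef_tij // !eqxx mulr1 tvecE.
  have [h1 h2] := ij_indexP q.
  rewrite wcoef_tij //; case: andP => [[/eqP e1 /eqP e2]|_];
    last by rewrite mulr0 scale0r.
  by case/eqP: qp; apply: ij_index_inj.
by apply: big1 => p _; have [h1 h2] := ij_indexP p; rewrite v0 // scale0r.
Qed.

Context {r : F}.
Hypotheses (r_neq0 : r != 0).

Local Notation m := (Defs.m r).
Local Notation nu := (Defs.nu r^-1 r n).
Local Notation avec := (@avec F n r).
Local Notation bvec := (@bvec F n r).

(** Settles the equalities between indices that remain after both sides have
    been expanded on a vector [t_ij]. *)
Ltac decide_indices :=
  repeat (case: ifP => ?); rewrite ?wcoefE ?wcoef_tij; try lia;
  repeat (case: andP => ? /=); first [ring | exfalso; lia].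

(** Action of [nu_k] on the coordinates [(s, t)] with [k < t]. *)
Lemma wcoef_nu_lt k s t v : v \in tspan F n -> (2 <= k < t)%N -> (0 < s < t)%N ->
  (t <= n)%N ->
  wcoef (nu k v) s t = if s == k.-1 then wcoef v k t
                    else if s == k then wcoef v k.-1 t - m * wcoef v k t
                    else r * wcoef v s t.
Proof.
move=> vT kt st tn; elim/tspan_ind: vT => [|x i j u ij jn _ IH].
  by rewrite linear0 !wcoef0 !mulr0 subr0 !if_same.
rewrite linearD linearZ /= (nuT r_neq0) //; last by lia.
rewrite wcoefD wcoefZ IH !wcoefE.
rewrite (wcoef_tij i j (s := s)) //.
rewrite (wcoef_tij i j (s := k) (t := t)) //; last by lia.
case: (altP (s =P _)) => [es|sk].
  have h : (0 < k.-1 < t)%N by lia.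
  by subst s; decide_indices.
case: (altP (s =P _)) => [es|sk']; last by decide_indices.
rewrite (wcoef_tij i j (s := k.-1) (t := t)) //; last by lia.
by subst s; decide_indices.
Qed.

(** Action of [nu_k] on the coordinates [(s, k)] with [s < k - 1]. *)
Lemma wcoef_nu_eq k s v : v \in tspan F n -> (0 < s < k.-1)%N -> (k <= n)%N ->
  wcoef (nu k v) s k = wcoef v s k.-1 - m * wcoef v s k.
Proof.
move=> vT sk kn; elim/tspan_ind: vT => [|x i j u ij jn _ IH].
  by rewrite linear0 !wcoef0 mulr0 subr0.
rewrite linearD linearZ /= (nuT r_neq0) //; last by lia.
rewrite wcoefD wcoefZ IH !wcoefE.
rewrite (wcoef_tij i j (s := s) (t := k.-1)) //; last by lia.
rewrite (wcoef_tij i j (s := s) (t := k)) //; last by lia.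
by decide_indices.
Qed.

Lemma wcoef_bvec j : (3 <= j <= n)%N -> wcoef (bvec j) 1 n = (j == n)%:R.
Proof.
move=> jn; rewrite !bvecE !wcoefE !wcoef_tij ?leqnn //; try lia.
rewrite /= (_ : (n == 2) = false); last by lia.
by rewrite !mulr0 !addr0 eq_sym.
Qed.

(** The coordinate [(1, n)] of [(nu_1 - r) v] is also the coefficient of [b_n]
    in it. *)
Lemma wcoef_nu1 v : (3 <= n)%N -> v \in tspan F n ->
  wcoef (nu 1 v) 1 n = r * wcoef v 1 n - r^-1 * wcoef v 1 n - wcoef v 2 n
    + \sum_(3 <= i < n) m * r ^+ (i - 3) * wcoef v i n.
Proof.
move=> n3 vT; elim/tspan_ind: vT => [|x i j u ij jn _ IH].
  by rewrite linear0 !wcoef0 big1 ?mulr0 ?subr0 ?addr0 // => i _; rewrite wcoef0 mulr0.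
rewrite linearD linearZ /= wcoefD wcoefZ IH.
under [X in _ = _ + X]eq_bigr => s _ do rewrite wcoefD wcoefZ mulrDr mulrCA.
rewrite big_split -mulr_sumr /= !(wcoefD, wcoefZ).
have [h1 h2] : (0 < 1 < n)%N /\ (0 < 2 < n)%N by lia.
rewrite (wcoef_tij i j h1 (leqnn n)) (wcoef_tij i j h2 (leqnn n)).
have -> : \sum_(3 <= s < n) m * r ^+ (s - 3) * wcoef (T i j) s n
    = if (3 <= i)%N && (j == n) then m * r ^+ (i - 3) else 0.
  rewrite (eq_big_nat _ _ (F2 := fun s => if s == i then
     if j == n then m * r ^+ (s - 3) else 0 else 0)); last first.
    move=> s sn; rewrite wcoef_tij ?leqnn //; last by lia.
    rewrite (eq_sym n j).
    by case: (s == i); case: (j == n); rewrite /= ?mulr1 ?mulr0.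
  rewrite -(big_mkcond (fun s => s == i)) /= big_nat1_eq.
  case: (altP (j =P n)) => [ejn|_]; last by rewrite andbF if_same.
  by rewrite andbT; congr (if _ then _ else _); lia.
set S := \sum_(_ <= _ < _) _.
have [i3|i3] := leqP 3 i.
  rewrite (nu1_T r_neq0) //; last by lia.
  rewrite !wcoefE !wcoef_bvec ?wcoef_tij; try lia.
  have -> : (i == n) = false by lia.
  have -> : (1 == i)%N = false by lia.
  have -> : (2 == i)%N = false by lia.
  rewrite (eq_sym j n); case: (n == j) => /=; ring.
have [i1|i2] : i = 1%N \/ i = 2%N by lia.
  subst i; have [j2|j3] : j = 2%N \/ (3 <= j)%N by lia.
    subst j; rewrite nu1_T12 // wcoefZ (wcoef_tij _ _ h1 (leqnn n)).
    by rewrite (_ : (n == 2) = false) /=; [ring|lia].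
  rewrite (nu1_T1 r_neq0); last by lia.
  rewrite !wcoefE wcoef_bvec ?(wcoef_tij _ _ h1 (leqnn n)); last by lia.
  by rewrite (eq_sym j n); case: (n == j) => /=; ring.
subst i; rewrite (nu1_T2 r_neq0); last by lia.
rewrite !wcoefE wcoef_bvec ?(wcoef_tij _ _ h1 (leqnn n)); last by lia.
by rewrite (eq_sym j n); case: (n == j) => /=; ring.
Qed.

End Coordinates.

(** * Irreducibility *)

Section Irreducibility.
Context {F : fieldType} {n : nat} {r : F}.
Hypotheses (r_neq0 : r != 0) (n_ge5 : (5 <= n)%N).

Local Notation m := (Defs.m r).
Local Notation nu := (Defs.nu r^-1 r n).
Local Notation T := (@tij F n).
Local Notation avec := (@avec F n r).
Local Notation bvec := (@bvec F n r).
Local Notation cvec := (@cvec F n r).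
Local Notation twist := (@twist F n r).

Lemma sum_geometric a b : (a <= b)%N ->
  \sum_(a <= j < b) m * r ^+ (2 * j + 1) = r ^+ (2 * a) - r ^+ (2 * b).
Proof.
move=> ab; rewrite -[RHS]opprB -(telescope_sumr (fun j => r ^+ (2 * j)) ab) -sumrN.
apply: eq_bigr => j _; rewrite mulnS !exprD expr1 /Defs.m.
by move: (r ^+ (2 * j)) => x; field; rewrite r_neq0.
Qed.

Variable W : {vspace V F n}.
Hypothesis invW : Defs.invariant r^-1 r W.

Lemma nu_in k v : (1 <= k <= n)%N -> v \in W -> nu k v \in W.
Proof. by move=> kn vW; apply: (subvP (invW kn)); apply: memv_img. Qed.

Lemma nuB_in k v : (1 <= k <= n)%N -> v \in W -> nu k v - r *: v \in W.
Proof. by move=> kn vW; rewrite memvB ?memvZ ?nu_in. Qed.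

Lemma twist_in k v : (1 <= k <= n)%N -> v \in W -> twist k v \in W.
Proof.
by move=> kn vW; rewrite twistE; apply: nuB_in => //; apply: nu_in => //; lia.
Qed.

Lemma memv_eq u v : u = v -> u \in W -> v \in W.
Proof. by move=> ->. Qed.

Lemma memv_unscale x v : x != 0 -> x *: v \in W -> v \in W.
Proof. by move=> x0 /(memvZ x^-1); rewrite scalerA mulVf // scale1r. Qed.

(** All the differences of a chain belong to [W] as soon as one does; only the
    first two are needed. *)
Lemma cvec_in g k : @chain F n r g -> (4 <= k <= n)%N -> cvec g k \in W ->
  cvec g 4 \in W /\ cvec g 5 \in W.
Proof.
move=> cg; elim: k => [|k IH] // kn ck.
have [k4|k4] : k = 3%N \/ (4 <= k < n)%N by lia.
  subst k; split => //.
  rewrite -(chain_cvec_up r_neq0 cg (k := 4)); last by lia.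
  by apply: nuB_in => //; lia.
apply: IH; first by lia.
rewrite -(chain_cvec_down r_neq0 cg (k := k)); last by lia.
by apply: nuB_in => //; lia.
Qed.

(** The vector [t_12] generates the span of the [t_ij]. *)
Lemma tij_in_all i j : T 1 2 \in W -> (0 < i < j)%N -> (j <= n)%N -> T i j \in W.
Proof.
move=> t12; have t1 k : (2 <= k <= n)%N -> T 1 k \in W.
  elim: k => [|k IH] // kn.
  have [->//|k2] : k = 1%N \/ (2 <= k)%N by lia.
  have -> : T 1 k.+1 = nu k.+1 (T 1 k).
    rewrite (nuT_far r_neq0); [|lia|lia|lia].
    by rewrite /= eqxx.
  by apply: nu_in; [lia|apply: IH; lia].
elim: i => [|i IH] // ij jn.
have [->|i1] : i = 0%N \/ (1 <= i)%N by lia.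
  by apply: t1; lia.
have -> : T i.+1 j = nu i.+1 (T i j).
  rewrite (nuT r_neq0); [|lia|lia|lia].
  by rewrite /= !eqxx /= ifN //; lia.
by apply: nu_in; [lia|apply: IH; lia].
Qed.

Lemma t12_of_b3 : r ^+ 4 != -1 -> bvec 3 \in W -> T 1 2 \in W.
Proof.
move=> r4 b3; have nb3 : nu 3 (bvec 3) \in W by apply: nu_in; [lia|].
have a3 : avec 3 \in W.
  apply: (@memv_unscale (r ^+ 2)); first by rewrite expf_neq0.
  by rewrite -(twist2_b3 r_neq0 n_ge5); apply: twist_in; [lia|].
apply: (@memv_unscale ((1 + r ^+ 4) / r)).
  by rewrite mulf_neq0 ?invr_eq0 // addrC addr_eq0.
have -> : ((1 + r ^+ 4) / r) *: T 1 2
    = (r + r^-1) *: nu 3 (bvec 3) - r ^+ 2 *: (bvec 3 - avec 3).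
  move: (nu3_b3 r_neq0 n_ge5); generalize (nu 3 (bvec 3)) => _ ->.
  rewrite avecE bvecE subnn expr0 mulr1.
  move: (T 1 2) (T 2 3) (T 1 3) => x y z; rewrite /Defs.m.
  by vec_field r_neq0.
by rewrite memvB ?memvZ // memvB.
Qed.

Lemma t12_of_cvec_a : r ^+ 2 != -1 -> r ^+ 4 != -1 ->
  cvec avec 4 \in W -> T 1 2 \in W.
Proof.
move=> r2 r4 c4; apply: t12_of_b3 => //.
have [_ c5] := cvec_in (chain_avec r_neq0) (k := 4) ltac:(lia) c4.
have b34 : bvec 3 + r *: bvec 4 \in W.
  apply: (@memv_unscale (r ^+ 4)^-1); first by rewrite invr_eq0 expf_neq0.
  have := twist_in (k := 1) ltac:(lia) c4; rewrite twist_cvec twist1_a3 //.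
  rewrite (twist1_a r_neq0 n_ge5 (j := 4) ltac:(lia)) subnn expr0 mulr1.
  apply: memv_eq; rewrite /Defs.m; move: (bvec 3) (bvec 4) => x y.
  by vec_field r_neq0.
have cb5 : cvec bvec 5 \in W.
  apply: (@memv_unscale (- (r ^+ 2)^-1)); first by rewrite oppr_eq0 invr_eq0 expf_neq0.
  have := twist_in (k := 1) ltac:(lia) c5; rewrite twist_cvec.
  rewrite (twist1_a r_neq0 n_ge5 (j := 4) ltac:(lia)).
  rewrite (twist1_a r_neq0 n_ge5 (j := 5) ltac:(lia)).
  rewrite subnn expr0 (_ : 5 - 4 = 1)%N // mulr1 /cvec.
  apply: memv_eq; rewrite /Defs.m.
  move: (bvec 3) (bvec 4) (bvec 5) => x y z.
  by vec_field r_neq0.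
have [cb4 _] := cvec_in (chain_bvec r_neq0) (k := 5) ltac:(lia) cb5.
apply: (@memv_unscale (1 + r ^+ 2)); first by rewrite addrC addr_eq0.
have -> : (1 + r ^+ 2) *: bvec 3 = (bvec 3 + r *: bvec 4) + r ^+ 2 *: cvec bvec 4.
  rewrite /cvec /=; move: (bvec 3) (bvec 4) => x y.
  by vec_field r_neq0.
by rewrite memvD ?memvZ.
Qed.

Lemma cvec_a_of_b : cvec bvec 5 \in W -> cvec avec 4 \in W.
Proof.
move=> c5; suff ca5 : cvec avec 5 \in W.
  by have [] := cvec_in (chain_avec r_neq0) (k := 5) ltac:(lia) ca5.
apply: (@memv_unscale (- r ^+ 2)); first by rewrite oppr_eq0 expf_neq0.
have := twist_in (k := 2) ltac:(lia) c5; rewrite twist_cvec.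
rewrite (twist2_b r_neq0 n_ge5 (j := 4) ltac:(lia)).
rewrite (twist2_b r_neq0 n_ge5 (j := 5) ltac:(lia)).
rewrite (_ : 4 - 2 = 2)%N // (_ : 5 - 2 = 3)%N // /cvec.
apply: memv_eq; rewrite /Defs.m.
move: (avec 3) (avec 4) (avec 5) => x y z.
by vec_field r_neq0.
Qed.

(** The second possibility for [W], the eigenvector common to
    [nu_4, ..., nu_n]. *)
Lemma cvec_a_of_sum : r ^+ (2 * (n - 3)) != -1 ->
  \sum_(3 <= j < n.+1) r ^+ j *: bvec j \in W -> cvec avec 4 \in W.
Proof.
move=> rn /(twist_in (k := 2) ltac:(lia)).
rewrite twist_sum => H.
(* The coefficients of the image in terms of the a_j; c_3 comes from summing
   the geometric progression of the components along a_3. *)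
pose c j := if j == 3%N then r ^+ (2 * n.+1) / r ^+ 3 else - r ^+ (j + 2).
have E : \sum_(3 <= j < n.+1) r ^+ j *: twist 2 (bvec j)
    = \sum_(3 <= j < n.+1) c j *: avec j.
  rewrite big_ltn; last by lia.
  rewrite [RHS]big_ltn; last by lia.
  rewrite (twist2_b3 r_neq0 n_ge5) (eq_big_nat _ _ (F2 := fun j =>
     c j *: avec j - (m * r ^+ (2 * j + 1) / r ^+ 3) *: avec 3)); last first.
    move=> j jn; rewrite (twist2_b r_neq0 n_ge5); last by lia.
    rewrite /c (_ : (j == 3) = false); last by lia.
    rewrite (_ : 2 * j + 1 = j + (j - 2) + 3)%N; last by lia.
    rewrite !exprD; move: (r ^+ j) (r ^+ (j - 2)) (avec j) (avec 3) => x y u v.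
    by vec_field r_neq0.
  rewrite sumrB -scaler_suml -mulr_suml sum_geometric //; last by lia.
  rewrite /c eqxx; move: (r ^+ (2 * n.+1)) (avec 3) (\sum_(_ <= _ < _) _) => x u v.
  by vec_field r_neq0.
rewrite E in H.
have c40 : c 4 - r * c 3 != 0.
  rewrite /c /= (_ : 2 * n.+1 = 2 * (n - 3) + 8)%N; last by lia.
  rewrite (exprD r (2 * (n - 3))) (_ : _ - _ = - (r ^+ 6 * (r ^+ (2 * (n - 3)) + 1))).
    by rewrite oppr_eq0 mulf_neq0 ?expf_neq0 // addr_eq0.
  by move: (r ^+ (2 * (n - 3))) => x; field; rewrite r_neq0.
apply: (memv_unscale c40).
have ca : chain avec := chain_avec r_neq0.
rewrite -(chain_sum r_neq0 c ca (k := 4)); last by lia.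
by apply: (nuB_in _ H); lia.
Qed.

(** The image of [nu_1 - r] lies in the span of the [b_j]. *)
Lemma nu1_image v : v \in tspan F n ->
  exists c : nat -> F, nu 1 v - r *: v = \sum_(3 <= j < n.+1) c j *: bvec j.
Proof.
have single k x : (3 <= k <= n)%N -> exists c : nat -> F,
    x *: bvec k = \sum_(3 <= j < n.+1) c j *: bvec j.
  move=> kn; exists (fun j => if j == k then x else 0).
  rewrite (eq_bigr (fun j => if j == k then x *: bvec j else 0)); last first.
    by move=> j _; case: ifP; rewrite ?scale0r.
  by rewrite -big_mkcond /= big_nat1_eq ifT //; lia.
have sum_closed (u v' : V F n) :
    (exists c : nat -> F, u = \sum_(3 <= j < n.+1) c j *: bvec j) ->
    (exists c : nat -> F, v' = \sum_(3 <= j < n.+1) c j *: bvec j) ->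
    exists c : nat -> F, u + v' = \sum_(3 <= j < n.+1) c j *: bvec j.
  move=> [c ->] [d ->]; exists (fun j => c j + d j).
  by rewrite -big_split /=; apply: eq_bigr => j _; rewrite scalerDl.
move=> vT; elim/(@tspan_ind F n): vT => [|x i j u ij jn _ IH].
  exists (fun=> 0); rewrite linear0 scaler0 subr0 big1 // => j _.
  by rewrite scale0r.
have -> : nu 1 (x *: T i j + u) - r *: (x *: T i j + u)
    = x *: (nu 1 (T i j) - r *: T i j) + (nu 1 u - r *: u).
  move: (nu 1) => f; rewrite linearD linearZ /= scalerDr opprD addrACA scalerBr.
  by rewrite !scalerA (mulrC x).
apply: (sum_closed _ _ _ IH).
have cancel (a b : V F n) : a + b - a = b by rewrite addrC addKr.
have cancel3 (a b c : V F n) : a + b + c - a = b + c by rewrite -(addrA a) cancel.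
have [i3|[i1|i2]] : (3 <= i)%N \/ i = 1%N \/ i = 2%N by lia.
- rewrite (nu1_T r_neq0) //; last by lia.
  rewrite cancel3 scalerDr !scalerA.
  by apply: sum_closed; apply: single; lia.
- subst i; have [->|j3] : j = 2%N \/ (3 <= j)%N by lia.
    rewrite nu1_T12; last by lia.
    exists (fun=> 0); rewrite subrr scaler0 big1 // => k _.
    by rewrite scale0r.
  rewrite (nu1_T1 r_neq0); last by lia.
  by rewrite cancel -scaleNr scalerA; apply: single; lia.
- subst i; rewrite (nu1_T2 r_neq0); last by lia.
  by rewrite cancel -scaleN1r scalerA; apply: single; lia.
Qed.

(** If [nu_1 = r] on [W], the linear form giving the coefficient of [b_n] in
    [(nu_1 - r) v] vanishes on [W].  Its composite with [nu_3], then those with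
    the other [nu_k], show that the coordinate [(i, n)] of an element of [W] is
    [r^(i-1)] times its coordinate [(1, n)]; on [W] the form itself is then a
    nonzero multiple of the coordinate [(1, n)]. *)
Lemma nu1_scalar_eq0 : r ^+ (2 * (n - 2)) != -1 -> (W <= tspan F n)%VS ->
  (forall v, v \in W -> nu 1 v = r *: v) -> forall v, v \in W -> v = 0.
Proof.
move=> rn WT nu1r; pose f (v : V F n) := \sum_(3 <= i < n) m * r ^+ (i - 3) * wcoef v i n.
have inT v : v \in W -> v \in tspan F n by move=> vW; apply: (subvP WT).
have f1 v : v \in W -> f v = r^-1 * wcoef v 1 n + wcoef v 2 n.
  have n3 : (3 <= n)%N by lia.
  move=> vW; have := wcoef_nu1 r_neq0 n3 (inT _ vW).
  rewrite nu1r // wcoefZ -/(f v); move: (f v) (wcoef v 1 n) (wcoef v 2 n) => x y z h.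
  have: r * y - (r * y - r^-1 * y - z + x) = 0 by rewrite {1}h subrr.
  by move/eqP; rewrite (_ : _ - _ = r^-1 * y + z - x) ?subr_eq0 => [/eqP//|]; ring.
have nuc k v i : v \in W -> (2 <= k < n)%N -> (0 < i < n)%N ->
    wcoef (nu k v) i n = if i == k.-1 then wcoef v k n
                    else if i == k then wcoef v k.-1 n - m * wcoef v k n
                    else r * wcoef v i n.
  by move=> vW kn i_n; rewrite (wcoef_nu_lt r_neq0) // inT.
(* Compare the relation f1 for v and for nu_3 v. *)
have c3 v : v \in W -> wcoef v 3 n = r * wcoef v 2 n.
  move=> vW; have n3 : (1 <= 3 <= n)%N by lia.
  have := f1 _ (nu_in n3 vW); have := f1 _ vW.
  rewrite /f big_ltn; last by lia.
  rewrite [in X in _ -> X -> _]big_ltn; last by lia.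
  have -> : \sum_(4 <= i < n) m * r ^+ (i - 3) * wcoef (nu 3 v) i n
     = r * \sum_(4 <= i < n) m * r ^+ (i - 3) * wcoef v i n.
    rewrite mulr_sumr; apply: eq_big_nat => i i_n.
    rewrite nuc //; [|lia|lia]; rewrite ifF; last by lia.
    by rewrite ifF; [ring|lia].
  rewrite !nuc //; try lia.
  rewrite subnn expr0 mulr1 /=; move: (\sum_(_ <= _ < _) _).
  move: (wcoef v 1 n) (wcoef v 2 n) (wcoef v 3 n) => x y z S.
  move=> e1 e2; apply/eqP; rewrite -subr_eq0.
  have -> : z - r * y = r ^+ 2 * (r * (m * z + S - (r^-1 * x + y)) -
     (m * (y - m * z) + r * S - (r^-1 * (r * x) + z))).
    by rewrite /Defs.m; field; rewrite r_neq0.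
  by rewrite e1 e2 !subrr mulr0 subrr mulr0.
(* Transport the relation to the other rows by the nu_k. *)
have ck k v : (3 <= k < n)%N -> v \in W -> wcoef v k n = r * wcoef v k.-1 n.
  elim: k v => [|k IH] v // kn vW.
  have [->|k3] : k = 2%N \/ (3 <= k)%N by lia.
    exact: c3.
  have k1 : (1 <= k.+1 <= n)%N by lia.
  have := IH _ ltac:(lia) (nu_in k1 vW).
  rewrite !nuc //; try lia.
  have [h1 h2] : (k.-1 == k) = false /\ (k.-1 == k.+1) = false by lia.
  by rewrite /= eqxx h1 h2 => ->; rewrite IH //; lia.
have c2 v : v \in W -> wcoef v 2 n = r * wcoef v 1 n.
  move=> vW; have n2 : (1 <= 2 <= n)%N by lia.
  have := c3 _ (nu_in n2 vW).
  rewrite !nuc //=; try lia.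
  rewrite c3 //; move: (wcoef v 1 n) (wcoef v 2 n) => x y h.
  have -> : r * x = r * (x - m * y) + r * m * y by ring.
  by rewrite -h /Defs.m; field; rewrite r_neq0.
have ci i v : (1 <= i < n)%N -> v \in W -> wcoef v i n = r ^+ i.-1 * wcoef v 1 n.
  elim: i => [|i IH] // i_n vW.
  have [->|[->|i3]] : i = 0%N \/ i = 1%N \/ (2 <= i)%N by lia.
  - by rewrite mul1r.
  - by rewrite c2.
  have i2 : (3 <= i.+1 < n)%N by lia.
  have i1 : (1 <= i < n)%N by lia.
  rewrite (ck _ _ i2 vW) (IH i1 vW).
  by rewrite mulrA -exprS prednK //; lia.
(* Substitute in f1 and sum the geometric progression. *)
have c1 v : v \in W -> wcoef v 1 n = 0.
  move=> vW; have := f1 _ vW.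
  rewrite (_ : f v = \sum_(3 <= i < n) m * r ^+ (2 * i + 1) * (wcoef v 1 n / r ^+ 5)).
    rewrite -mulr_suml sum_geometric //; last by lia.
    rewrite c2 // (_ : 2 * n = 2 * (n - 2) + 4)%N; last by lia.
    rewrite exprD => /eqP; rewrite -subr_eq0.
    rewrite (_ : _ - _ = - ((r ^+ (2 * (n - 2)) + 1) * r^-1 * wcoef v 1 n)).
      rewrite oppr_eq0 !mulf_eq0 invr_eq0 (negPf r_neq0) addr_eq0 (negPf rn).
      by move/eqP.
    move: (r ^+ (2 * (n - 2))) (wcoef v 1 n) => x y.
    by field; rewrite r_neq0.
  apply: eq_big_nat => i i_n; rewrite ci //; last by lia.
  rewrite (_ : 2 * i + 1 = (i - 3) + i.-1 + 5)%N; last by lia.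
  rewrite !exprD; move: (r ^+ _) (r ^+ _) (wcoef v 1 n) => x y z.
  by field; rewrite r_neq0.
(* The column n vanishes on W, hence so do the others: nu_k exchanges the
   columns k - 1 and k. *)
have cd d i v : v \in W -> (0 < i < n - d)%N -> wcoef v i (n - d) = 0.
  elim: d i v => [|d IH] i v vW id.
    rewrite subn0 ci ?c1 ?mulr0 //; lia.
  have k1 : (1 <= n - d <= n)%N by lia.
  have := IH i _ (nu_in k1 vW) ltac:(lia).
  rewrite (wcoef_nu_eq r_neq0) ?inT //; [|lia|lia].
  have id' : (0 < i < n - d)%N by lia.
  have e : ((n - d).-1 = n - d.+1)%N by lia.
  by rewrite (IH i v vW id') mulr0 subr0 e.
move=> v vW; apply: wcoef_eq0 => [|i j ij jn]; first exact: inT.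
by rewrite (_ : j = n - (n - j))%N; [apply: cd => //; lia|lia].
Qed.

Lemma tspan_minimal : r ^+ 2 != -1 -> r ^+ 4 != -1 ->
  r ^+ (2 * (n - 2)) != -1 -> r ^+ (2 * (n - 3)) != -1 ->
  (W <= tspan F n)%VS -> W = 0%VS \/ W = tspan F n.
Proof.
move=> r2 r4 rn2 rn3 WT; have n1 : (1 <= 1 <= n)%N by lia.
have [W0|W0] := eqVneq W 0%VS; [by left|right].
suff t12 : T 1 2 \in W.
  apply/eqP; rewrite eqEsubv WT /=; apply/span_subvP => _ /codomP[p ->].
  have [ij jn] := ij_indexP p.
  by rewrite tvecE tij_in_all.
suff c4 : cvec avec 4 \in W by exact: t12_of_cvec_a.
(* The first step of the argument, applied to a basis of W. *)
have [v vW nv] : exists2 v, v \in W & nu 1 v - r *: v != 0.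
  case: (boolP (has (fun v => nu 1 v - r *: v != 0) (vbasis W)))
    => [/hasP[v vW nv]|/hasPn h].
    by exists v => //; apply: vbasis_mem.
  case/eqP: W0; apply/eqP; rewrite -subv0; apply/subvP => v vW.
  rewrite memv0; apply/eqP; apply: (nu1_scalar_eq0 rn2 WT) vW => {}v vW.
  rewrite (coord_vbasis vW) linear_sum scaler_sumr; apply: eq_bigr => i _.
  rewrite linearZ /= scalerA mulrC -scalerA; congr (_ *: _).
  apply/eqP; rewrite -subr_eq0 -[_ == 0]negbK; apply: h; exact: memt_nth.
have uW := nuB_in n1 vW.
have [c cE] := nu1_image (subvP WT _ vW); rewrite {}cE in nv uW.
have cb := chain_bvec (n := n) r_neq0.
case: (boolP (all (fun k => c k == r * c k.-1) (iota 4 (n - 3)))) => [/allP ck|/allPn[k]].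
  have cE j : (3 <= j <= n)%N -> c j = c 3 / r ^+ 3 * r ^+ j.
    elim: j => [|j IH] // jn.
    have [->|j3] : j = 2%N \/ (3 <= j <= n)%N by clear -jn; lia.
      by rewrite mulfVK // expf_neq0.
    have /ck/eqP -> : j.+1 \in iota 4 (n - 3).
      by rewrite mem_iota; clear -jn j3; lia.
    by rewrite /= IH // (exprS r j) mulrCA.
  have sE : \sum_(3 <= j < n.+1) c j *: bvec j
      = (c 3 / r ^+ 3) *: \sum_(3 <= j < n.+1) r ^+ j *: bvec j.
    rewrite scaler_sumr; apply: eq_big_nat => j jn.
    by rewrite cE ?scalerA.
  rewrite {}sE in nv uW; apply: cvec_a_of_sum => //.
  apply: memv_unscale uW; apply: contra nv => /eqP ->.
  by rewrite scale0r.
rewrite mem_iota => k4 ck.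
have [k1 kn] : (4 <= k <= n)%N /\ (1 <= k <= n)%N by clear -k4 n_ge5; lia.
apply: cvec_a_of_b.
apply: (proj2 (cvec_in cb k1 _)).
apply: (@memv_unscale (c k - r * c k.-1)); first by rewrite subr_eq0.
by rewrite -(chain_sum r_neq0 c cb k1); exact: nuB_in.
Qed.

End Irreducibility.

(** * Dimensions and uniqueness *)

Section Dimensions.
Context {F : fieldType} {n : nat}.
Local Notation T := (@tij F n).

Lemma card_ij_index : #|{: ij_index n}| = (n * (n - 1) %/ 2)%N.
Proof.
rewrite card_sig -sum1_card.
rewrite -(pair_big_dep (fun i : 'I_n.+1 => (0 < i)%N)
  (fun i j : 'I_n.+1 => (i < j)%N) (fun _ _ => 1%N)) /=.
rewrite (eq_bigr (fun i : 'I_n.+1 => n - i)%N) => [|i _]; last first.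
  rewrite -(big_geq_mkord i.+1 n.+1 xpredT (fun=> 1%N)).
  by rewrite sum_nat_const_nat muln1 subSS.
rewrite big_mkcond big_ord_recl /= add0n.
(* Row i has n - i pairs; count the rows from the last one. *)
rewrite (reindex_inj rev_ord_inj) /=.
rewrite (eq_bigr (fun i : 'I_n => i : nat)) => [|i _];
  last by case: i => /= i; rewrite /bump; lia.
by rewrite -(big_mkord xpredT id) bin2_sum bin2 divn2 subn1.
Qed.

Lemma free_tvec (s : seq (ij_index n)) : uniq s -> free [seq tvec F p | p <- s].
Proof.
elim: s => [|p s IH] /=; first by rewrite nil_free.
move=> /andP[ps us]; rewrite free_cons IH // andbT; apply/negP.
move=> /(@coord_span _ _ _ (in_tuple _)) /(congr1 (fun v : V F n => v (false, p))).
rewrite !ffunE !eqxx /= subr0 sum_ffunE big1 => [/eqP|i _]; first by rewrite oner_eq0.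
rewrite ffunE.
have /mapP[q qs ->] : (in_tuple [seq tvec F p | p <- s])`_i
   \in [seq tvec F p | p <- s] by apply: mem_nth.
rewrite !ffunE /= subr0; case: andP => [[/eqP h1 /eqP h2]|_]; last by rewrite scaler0.
by case/negP: ps; rewrite (ij_index_inj h1 h2).
Qed.

Lemma dim_tspan : \dim (tspan F n) = (n * (n - 1) %/ 2)%N.
Proof.
have /eqnP -> := free_tvec (enum_uniq {: ij_index n}).
by rewrite size_map -cardE card_ij_index.
Qed.

Lemma dim_V : \dim {:V F n} = (2 * (n * (n - 1) %/ 2))%N.
Proof.
have -> : \dim {:V F n} = (#|{: V_basis n}| * 1)%N by rewrite dimvf.
by rewrite muln1 card_prod card_bool card_ij_index.
Qed.

Lemma t12_neq0 : (2 <= n)%N -> T 1 2 != 0.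
Proof.
move=> n2; apply/eqP => /(congr1 (fun v => wcoef v 1 2)).
by rewrite wcoef_tij // wcoef0 => /eqP; rewrite oner_eq0.
Qed.

Context {r : F}.
Hypotheses (r_neq0 : r != 0) (n_ge5 : (5 <= n)%N).

Local Notation m := (Defs.m r).
Local Notation nu := (Defs.nu r^-1 r n).
Local Notation avec := (@avec F n r).
Local Notation bvec := (@bvec F n r).

Lemma bvec_in j : bvec j \in tspan F n.
Proof. by rewrite bvecE !memvD ?memvZ ?tij_in. Qed.

Lemma tspan_invariant : Defs.invariant r^-1 r (tspan F n).
Proof.
move=> k kn; apply/subvP => _ /memv_imgP[v vT ->].
elim/(@tspan_ind F n): vT => [|x i j u ij jn _ IH].
  by rewrite linear0 mem0v.
rewrite linearD linearZ /= memvD ?memvZ {IH}//.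
have [k2|->] : (2 <= k)%N \/ k = 1%N by lia.
  rewrite (nuT r_neq0) //.
  by do ?case: ifP => _; rewrite ?memvB ?memvZ ?tij_in.
have [i3|[i1|i2]] : (3 <= i)%N \/ i = 1%N \/ i = 2%N by lia.
- rewrite (nu1_T r_neq0) //; last by lia.
  by rewrite !memvD ?memvZ ?tij_in ?bvec_in.
- subst i; have [->|j3] : j = 2%N \/ (3 <= j <= n)%N by lia.
    by rewrite nu1_T12 ?memvZ ?tij_in //; lia.
  by rewrite (nu1_T1 r_neq0) // memvB ?memvZ ?tij_in ?bvec_in.
- have j3 : (3 <= j <= n)%N by lia.
  by subst i; rewrite (nu1_T2 r_neq0) // memvB ?memvZ ?tij_in ?bvec_in.
Qed.

(** The quadratic Hecke relation holds on the span of the [t_ij], but not on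
    [V]. *)
Lemma hecke_nu2 v : v \in tspan F n -> nu 2 (nu 2 v) + m *: nu 2 v - v = 0.
Proof.
move=> vT; elim/(@tspan_ind F n): vT => [|x i j u ij jn _ IH].
  by rewrite !linear0 !addr0.
have -> : nu 2 (nu 2 (x *: T i j + u)) + m *: nu 2 (x *: T i j + u)
    - (x *: T i j + u)
    = x *: (nu 2 (nu 2 (T i j)) + m *: nu 2 (T i j) - T i j)
      + (nu 2 (nu 2 u) + m *: nu 2 u - u).
  move: (nu 2) => f; rewrite !linearD !linearZ /=.
  move: (f (f (T i j))) (f (T i j)) (f (f u)) (f u) (T i j) => a b c d e.
  by vec_ring.
rewrite IH addr0 {IH}; apply/eqP; rewrite scaler_eq0; apply/orP; right; apply/eqP.
have Z (y : F) (z : V F n) : nu 2 (y *: z) = y *: nu 2 z by rewrite linearZ.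
have rr : r * r + m * r - 1 = 0 by rewrite /Defs.m; field; rewrite r_neq0.
have eig (z : V F n) : nu 2 z = r *: z -> nu 2 (nu 2 z) + m *: nu 2 z - z = 0.
  by move=> ez; rewrite ez Z ez !scalerA -scalerDl -{2}(scale1r z) -scalerBl rr scale0r.
have [i3|[i1|i2]] : (3 <= i)%N \/ i = 1%N \/ i = 2%N by lia.
- by apply: eig; rewrite (nu2_T r_neq0) // i3; case/andP: ij.
- subst i; have [->|j3] : j = 2%N \/ (3 <= j <= n)%N by lia.
    by apply: eig; rewrite (nu2_T12 r_neq0) //; lia.
  have e1 : nu 2 (T 1 j) = T 2 j.
    by rewrite (nu2_T1 r_neq0) // avecE scalerBr opprB addrC
         scalerA divff // scale1r subrK.
  rewrite e1 (nu2_T2 r_neq0) // avecE.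
  move: (T 1 j) (T 2 j) => y z; rewrite /Defs.m.
  by vec_field r_neq0.
- have j3 : (3 <= j <= n)%N by lia.
  subst i.
  have e2 : nu 2 (T 2 j) = T 1 j - m *: T 2 j.
    rewrite (nu2_T2 r_neq0) // avecE.
    move: (T 1 j) (T 2 j) => y z; rewrite /Defs.m.
    by vec_field r_neq0.
  have e1 : nu 2 (T 1 j) = T 2 j.
    by rewrite (nu2_T1 r_neq0) // avecE scalerBr opprB addrC
         scalerA divff // scale1r subrK.
  have -> : nu 2 (nu 2 (T 2 j)) = T 2 j - m *: (T 1 j - m *: T 2 j).
    by rewrite e2 linearB /= Z e1 e2.
  rewrite e2; move: (T 1 j) (T 2 j) => y z.
  by vec_ring.
Qed.


Local Notation w := (Defs.w F n).
Local Notation wh := (Defs.wh F n).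

(** The span of the [t_ij] has no invariant complement in [V]. *)
Lemma no_complement (U : {vspace V F n}) : r ^+ 2 != 1 ->
  Defs.invariant r^-1 r U -> (U + tspan F n = {:V F n})%VS ->
  (U :&: tspan F n != 0)%VS.
Proof.
move=> r2 invU UT; apply/eqP => U0.
have nuU k v : (1 <= k <= n)%N -> v \in U -> nu k v \in U by exact: nu_in.
have [n1 n2 n3] : [/\ (1 <= 1 <= n)%N, (1 <= 2 <= n)%N & (1 <= 3 <= n)%N].
  by split; lia.
have [p12 p13 p23] : [/\ (2 <= n)%N, (3 <= n)%N & (3 <= n)%N] by split; lia.
have m0 : m != 0.
  apply: contra r2 => /eqP m0; apply/eqP.
  have <- : 1 - r * m = r ^+ 2 by rewrite /Defs.m; field; rewrite r_neq0.
  by rewrite m0 mulr0 subr0.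
(* nu_2 violates the Hecke relation at w_13, by the vector m w_12. *)
have e13 : nu 2 (w 1 3) = w 2 3 by rewrite nu_wbar.
have e23 : nu 2 (w 2 3) = w 1 3 + m *: w 1 2 - m *: w 2 3.
  by rewrite nu_wbar // /nu_basis /= /nuk_basis /= mulr1.
have [u uU [t tT ut]] : exists2 u, u \in U & exists2 t, t \in tspan F n &
    w 1 3 = u + t.
  by apply/memv_addP; rewrite UT memvf.
have w12 : w 1 2 \in U.
  apply: (memv_unscale m0).
  have -> : m *: w 1 2 = nu 2 (nu 2 u) + m *: nu 2 u - u.
    have <- : nu 2 (nu 2 (w 1 3)) + m *: nu 2 (w 1 3) - w 1 3 = m *: w 1 2.
      rewrite e13 e23; move: (w 1 3) (w 1 2) (w 2 3) => x y z.
      by vec_ring.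
    have := hecke_nu2 tT; rewrite ut; move: (nu 2) => f; rewrite !linearD /= => E.
    rewrite -[RHS]addr0 -E.
    move: (f (f u)) (f u) (f (f t)) (f t) => x y z x'.
    by vec_ring.
  by rewrite memvB ?memvD ?memvZ ?nuU.
have w13 : w 1 3 \in U by rewrite (_ : w 1 3 = nu 3 (w 1 2)) ?nuU // nu_wbar.
have w23 : w 2 3 \in U by rewrite -e13 nuU.
have q : wh 1 3 + m *: wh 1 2 \in U.
  have -> : wh 1 3 + m *: wh 1 2 = nu 1 (w 2 3) + m *: w 2 3.
    by rewrite nu_wbar // /nu_basis /= /nu1_basis /= mulr1 subrK.
  by rewrite memvD ?memvZ ?nuU.
have wh12 : wh 1 2 \in U.
  have -> : wh 1 2 = nu 3 (wh 1 3 + m *: wh 1 2) - (m * r) *: w 2 3.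
    rewrite linearD linearZ /= !nu_wbar // /nu_basis /= /nuk_basis /=.
    rewrite (_ : m / (r^-1 * 1) = m * r); last by rewrite mulr1 invrK.
    by rewrite -/(Defs.wh F n 1 2) -/(Defs.wh F n 1 3); rewrite subrK addrK.
  by rewrite memvB ?memvZ ?nuU.
have /eqP := t12_neq0 p12; apply; apply/eqP; rewrite -memv0 -U0 memv_cap tij_in andbT.
by rewrite tijE memvB.
Qed.

Theorem tspan_irreducible_unique : r ^+ 2 != 1 -> r ^+ 2 != -1 -> r ^+ 4 != -1 ->
  r ^+ (2 * (n - 2)) != -1 -> r ^+ (2 * (n - 3)) != -1 ->
  irreducible_invariant r^-1 r (tspan F n) /\
  forall U : {vspace V F n}, irreducible_invariant r^-1 r U ->
    \dim U = (n * (n - 1) %/ 2)%N -> U = tspan F n.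
Proof.
move=> r21 r2 r4 rn2 rn3.
have T0 : tspan F n != 0%VS.
  apply/eqP => T0; have /eqP := t12_neq0 (ltac:(lia) : (2 <= n)%N); apply.
  by apply/eqP; rewrite -memv0 -T0 tij_in.
split.
  split=> //; first exact: tspan_invariant.
  by move=> W invW WT; exact: (tspan_minimal r_neq0 n_ge5 invW r2 r4 rn2 rn3 WT).
move=> U [invU U0 irrU] dimU.
have invUT : Defs.invariant r^-1 r (U :&: tspan F n)%VS.
  move=> k kn; apply/subvP => _ /memv_imgP[v vUT ->].
  move: vUT; rewrite memv_cap => /andP[vU vT].
  by rewrite memv_cap (nu_in invU kn vU) (nu_in tspan_invariant kn vT).
case: (irrU _ invUT (capvSl _ _)) => [UT0|UTU].
  have UT : (U + tspan F n = {:V F n})%VS.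
    apply/eqP; rewrite eqEdim subvf /= dim_V dimv_disjoint_sum // dimU dim_tspan.
    by rewrite mul2n addnn.
  by have := no_complement r21 invU UT; rewrite UT0 eqxx.
apply/eqP; rewrite eqEdim dimU dim_tspan leqnn andbT.
by apply/capv_idPl.
Qed.

End Dimensions.

Theorem theorem7 (R : realType) (n : nat) (l r : complex R)
    (n_ge5 : (5 <= n)%N) (l_neq0 : l != 0) (r_neq0 : r != 0)
    (r_neq1 : forall k : nat, (1 <= k <= n)%N -> r ^+ (2 * k) != 1)
    (r_neqN1 : forall k : nat, (1 <= k <= n.-1)%N -> r ^+ (2 * k) != -1)
    (l_eq : l = 1 / r) :
  let F := gen_field l r in
  let irr_dim (U : {vspace V F n}) :=
    irreducible_invariant (gen_l l r) (gen_r l r) U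
    /\ \dim U = (n * (n - 1) %/ 2)%N in
  (exists! U : {vspace V F n}, irr_dim U)
  /\ (forall U : {vspace V F n}, irr_dim U -> U = tspan F n).
Proof.
move=> F irr_dim; pose q : F := gen_r l r.
have qX d : val (q ^+ d) = r ^+ d by rewrite rmorphXn.
have q0 : q != 0 by rewrite -(inj_eq val_inj).
have q1 d : (1 <= d <= n)%N -> q ^+ (2 * d) != 1.
  by move=> dn; rewrite -(inj_eq val_inj) qX rmorph1 r_neq1.
have qN1 d : (1 <= d <= n.-1)%N -> q ^+ (2 * d) != -1.
  by move=> dn; rewrite -(inj_eq val_inj) qX rmorphN1 r_neqN1.
(* The hypotheses on r descend to the subfield Q(l, r). *)
have ql : gen_l l r = q^-1 by apply: val_inj; rewrite fmorphV /= l_eq div1r.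
have [irrT uniqT] : irreducible_invariant (gen_l l r) q (tspan F n) /\
    forall U : {vspace V F n}, irreducible_invariant (gen_l l r) q U ->
    \dim U = (n * (n - 1) %/ 2)%N -> U = tspan F n.
  rewrite ql; apply: tspan_irreducible_unique => //.
  - by apply: (q1 1%N); lia.
  - by apply: (qN1 1%N); lia.
  - by apply: (qN1 2%N); lia.
  - by apply: qN1; lia.
  - by apply: qN1; lia.
split; last by move=> U [irrU dimU]; apply: uniqT.
exists (tspan F n); split; first by split; [exact: irrT|exact: dim_tspan].
by move=> U [irrU dimU]; rewrite (uniqT U).
Qed.
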